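(* The following problem (\textsc{MSO/DMS-MC}) is undecidable: given a database-manipulating system (DMS) $\mathcal{S}$ and an MSO-FO sentence $\phi$ over the schema of $\mathcal{S}$, decide whether $\rho \models \phi$ for every run $\rho \in \textsf{Runs}(\mathcal{S})$.
   Context: Fix a countably infinite data domain $\Delta$. A relational schema $\mathcal{R}$ is a finite set of relation names $R/a$ with arities $a\ge 0$. A database instance over $\mathcal{R}$ and a set $D$ is a finite set of facts $R(e_1,\dots,e_a)$ with $R/a\in\mathcal{R}$ and $e_i\in D$; a nullary relation $p/0$ is ''true'' in $I$ iff $p\in I$. The active domain $\mathrm{adom}(I)$ is the set of elements of $\Delta$ occurring in facts of $I$. A $\mathrm{FOL}(\mathcal{R})$ query is a first-order formula with equality over $\mathcal{R}$ (atoms $\mathsf{true}$, $R(u_1,\dots,u_a)$, $u_1=u_2$; connectives $\neg,\wedge$; quantifier $\exists u$), evaluated with active-domain semantics: $\exists u$ ranges over $\mathrm{adom}(I)$; $I,\sigma\models Q$ denotes satisfaction under a substitution $\sigma$ of the free variables. For an instance $I$ whose arguments are variables and a substitution $\sigma$ of these variables into $\Delta$, $\sigma(I)$ denotes the instance obtained by replacing each variable $u$ by $\sigma(u)$. A DMS over $\Delta$ and $\mathcal{R}$ is a pair $\mathcal{S}=\langle I_0,\textsc{acts}\rangle$ where $I_0$ is an instance with $\mathrm{adom}(I_0)=\emptyset$ (it only fixes truth values of nullary relations) and $\textsc{acts}$ is a finite set of actions $\alpha=\langle \vec u,\vec v,Q,\mathit{Del},\mathit{Add}\rangle$: $\vec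 u,\vec v$ are disjoint finite sets of data variables (action parameters and fresh-input variables), $Q$ is a $\mathrm{FOL}(\mathcal{R})$ query whose free variables are exactly $\vec u$, $\mathit{Del}$ is an instance over $\mathcal{R}$ with arguments in $\vec u$, and $\mathit{Add}$ is an instance over $\mathcal{R}$ with arguments in $\vec u\cup\vec v$ in which every variable of $\vec v$ occurs. Configurations are pairs $\langle I,H\rangle$ with $I$ an instance over $\mathcal{R},\Delta$ and $H\subseteq\Delta$ (history set). There is a transition $\langle I,H\rangle\xrightarrow{\alpha:\sigma}\langle I',H'\rangle$ iff $\sigma:\vec u\cup\vec v\to\Delta$ satisfies: $\sigma(u)\in\mathrm{adom}(I)$ for $u\in\vec u$; $\sigma(v)\notin H$ for $v\in\vec v$; $\sigma$ is injective on $\vec v$; $I,\sigma|_{\vec u}\models Q$; $I'=(I\setminus\sigma(\mathit{Del}))\cup\sigma(\mathit{Add})$; and $H'=H\cup\{\sigma(v)\mid v\in\vec v\}$. An extended run is an infinite sequence $\langle I_0,H_0\rangle\xrightarrow{\alpha_0:\sigma_0}\langle I_1,H_1\rangle\xrightarrow{\alpha_1:\sigma_1}\cdots$ with $H_0=\emptyset$; the run it generates is $I_0,I_1,I_2,\dots$; $\textsf{Runs}(\mathcal{S})$ is the set of all runs. MSO-FO formulae over $\mathcal{R}$: $\phi ::= Q@x \mid x<y \mid x\in X \mid \neg\phi \mid \phi\wedge\phi \mid \exists x.\phi \mid \exists X.\phi \mid \exists^g u.\phi$, where $x,y$ are first-order position variables (ranging over $\mathbb{N}$), $X$ is a second-order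 position variable (ranging over subsets of $\mathbb{N}$), $u$ is a data variable and $Q$ is a $\mathrm{FOL}(\mathcal{R})$ query. Over a run $\rho=I_0,I_1,\dots$ with $\mathrm{gadom}(\rho)=\bigcup_i\mathrm{adom}(I_i)$: $\rho,\sigma\models Q@x$ iff, with $i=\sigma(x)$, the values $\sigma$ assigns to the free variables of $Q$ lie in $\mathrm{adom}(I_i)$ and $I_i,\sigma|_{\mathrm{free}(Q)}\models Q$; $x<y$ and $x\in X$ are interpreted naturally on $\mathbb{N}$; $\exists^g u.\phi$ holds iff there is $e\in\mathrm{gadom}(\rho)$ with $\phi$ holding when $u\mapsto e$; the remaining cases are standard. A sentence has no free variables. *)

(* Defs.v *)
From HB Require Import structures.
From mathcomp Require Import all_boot.
From mathcomp Require Import finmap.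

Set Implicit Arguments.
Unset Strict Implicit.
Unset Printing Implicit Defensive.

Local Open Scope fset_scope.

(* Data domain: Delta := nat (a countably infinite set).                     *)
(* Schema: a list of arities; relation name r (r < size sch) has arity       *)
(* nth 0 sch r.  Data variables, position variables and set variables are    *)
(* represented by natural numbers (three separate name spaces).              *)

Definition schema := seq nat.
Definition arity (sch : schema) (r : nat) : nat := nth 0 sch r.

Inductive fol : Type :=
| FTrue
| FAtom of nat & seq nat          (* R(u_1,...,u_a) *)
| FEq of nat & nat
| FNot of fol
| FAnd of fol & fol
| FEx of nat & fol.

Inductive mso : Type :=
| MAt of fol & nat                (* Q @ x *)
| MLt of nat & nat
| MIn of nat & nat                (* x \in X *)
| MNot of mso
| MAnd of mso & mso
| MEx1 of nat & mso               (* exists x (position) *)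
| MEx2 of nat & mso               (* exists X (set of positions) *)
| MExG of nat & mso.              (* exists^g u (data) *)

(* A fact with arguments (data values or variables): relation name, args. *)
Definition fact := (nat * seq nat)%type.

Record action := Action {
  params : seq nat;
  fresh  : seq nat;
  guard  : fol;
  del    : seq fact;         (* Del, arguments are variables *)
  add    : seq fact          (* Add, arguments are variables *)
}.

Record dms := DMS {
  init : seq nat;            (* nullary relations true in I_0 *)
  acts : seq action
}.

Fixpoint fol_enc (q : fol) : GenTree.tree (seq nat) :=
  match q with
  | FTrue => GenTree.Node 0 [::]
  | FAtom r a => GenTree.Node 1 [:: GenTree.Leaf [:: r]; GenTree.Leaf a]
  | FEq u v => GenTree.Node 2 [:: GenTree.Leaf [:: u; v]]
  | FNot q => GenTree.Node 3 [:: fol_enc q]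
  | FAnd q1 q2 => GenTree.Node 4 [:: fol_enc q1; fol_enc q2]
  | FEx u q => GenTree.Node 5 [:: GenTree.Leaf [:: u]; fol_enc q]
  end.

Fixpoint fol_dec (t : GenTree.tree (seq nat)) : option fol :=
  match t with
  | GenTree.Node 0 [::] => Some FTrue
  | GenTree.Node 1 [:: GenTree.Leaf [:: r]; GenTree.Leaf a] => Some (FAtom r a)
  | GenTree.Node 2 [:: GenTree.Leaf [:: u; v]] => Some (FEq u v)
  | GenTree.Node 3 [:: t1] =>
      if fol_dec t1 is Some q then Some (FNot q) else None
  | GenTree.Node 4 [:: t1; t2] =>
      match fol_dec t1, fol_dec t2 with
      | Some q1, Some q2 => Some (FAnd q1 q2)
      | _, _ => None
      end
  | GenTree.Node 5 [:: GenTree.Leaf [:: u]; t1] =>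
      if fol_dec t1 is Some q then Some (FEx u q) else None
  | _ => None
  end.

Lemma fol_encK : pcancel fol_enc fol_dec.
Proof. by elim=> //= [q ->|q1 -> q2 ->|u q ->]. Qed.

HB.instance Definition _ := Countable.copy fol (pcan_type fol_encK).

Fixpoint mso_enc (f : mso) : GenTree.tree fol :=
  match f with
  | MAt q x => GenTree.Node 0 [:: GenTree.Leaf q; GenTree.Leaf (FEq x x)]
  | MLt x y => GenTree.Node 1 [:: GenTree.Leaf (FEq x y)]
  | MIn x X => GenTree.Node 2 [:: GenTree.Leaf (FEq x X)]
  | MNot f => GenTree.Node 3 [:: mso_enc f]
  | MAnd f1 f2 => GenTree.Node 4 [:: mso_enc f1; mso_enc f2]
  | MEx1 x f => GenTree.Node 5 [:: GenTree.Leaf (FEq x x); mso_enc f]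
  | MEx2 x f => GenTree.Node 6 [:: GenTree.Leaf (FEq x x); mso_enc f]
  | MExG x f => GenTree.Node 7 [:: GenTree.Leaf (FEq x x); mso_enc f]
  end.

Fixpoint mso_dec (t : GenTree.tree fol) : option mso :=
  match t with
  | GenTree.Node 0 [:: GenTree.Leaf q; GenTree.Leaf (FEq x _)] => Some (MAt q x)
  | GenTree.Node 1 [:: GenTree.Leaf (FEq x y)] => Some (MLt x y)
  | GenTree.Node 2 [:: GenTree.Leaf (FEq x y)] => Some (MIn x y)
  | GenTree.Node 3 [:: t1] =>
      if mso_dec t1 is Some f then Some (MNot f) else None
  | GenTree.Node 4 [:: t1; t2] =>
      match mso_dec t1, mso_dec t2 with
      | Some f1, Some f2 => Some (MAnd f1 f2)
      | _, _ => None
      end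
  | GenTree.Node 5 [:: GenTree.Leaf (FEq x _); t1] =>
      if mso_dec t1 is Some f then Some (MEx1 x f) else None
  | GenTree.Node 6 [:: GenTree.Leaf (FEq x _); t1] =>
      if mso_dec t1 is Some f then Some (MEx2 x f) else None
  | GenTree.Node 7 [:: GenTree.Leaf (FEq x _); t1] =>
      if mso_dec t1 is Some f then Some (MExG x f) else None
  | _ => None
  end.

Lemma mso_encK : pcancel mso_enc mso_dec.
Proof.
by elim=> //= [f ->|f1 -> f2 ->|x f ->|x f ->|x f ->].
Qed.

HB.instance Definition _ := Countable.copy mso (pcan_type mso_encK).

Definition action_enc (a : action) :=
  (params a, fresh a, guard a, del a, add a).
Definition action_dec (t : seq nat * seq nat * fol * seq fact * seq fact) :=
  let: (p, v, q, d, ad) := t in Action p v q d ad.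
Lemma action_encK : cancel action_enc action_dec. Proof. by case. Qed.
HB.instance Definition _ := Countable.copy action (can_type action_encK).

Definition dms_enc (S : dms) := (init S, acts S).
Definition dms_dec (t : seq nat * seq action) := DMS t.1 t.2.
Lemma dms_encK : cancel dms_enc dms_dec. Proof. by case. Qed.
HB.instance Definition _ := Countable.copy dms (can_type dms_encK).

Definition wf_atom (sch : schema) (f : fact) : Prop :=
  f.1 < size sch /\ size f.2 = arity sch f.1.

Fixpoint wf_fol (sch : schema) (q : fol) : Prop :=
  match q with
  | FTrue => True
  | FAtom r a => wf_atom sch (r, a)
  | FEq _ _ => True
  | FNot q => wf_fol sch q
  | FAnd q1 q2 => wf_fol sch q1 /\ wf_fol sch q2
  | FEx _ q => wf_fol sch q
  end.

Fixpoint fv (q : fol) : seq nat :=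
  match q with
  | FTrue => [::]
  | FAtom _ a => a
  | FEq u v => [:: u; v]
  | FNot q => fv q
  | FAnd q1 q2 => fv q1 ++ fv q2
  | FEx u q => [seq w <- fv q | w != u]
  end.

Definition wf_action (sch : schema) (a : action) : Prop :=
  [/\ (forall x, x \in params a -> x \notin fresh a),
      wf_fol sch (guard a) /\ fv (guard a) =i params a,
      (forall f, f \in del a -> wf_atom sch f /\ {subset f.2 <= params a}),
      (forall f, f \in add a ->
         wf_atom sch f /\ {subset f.2 <= params a ++ fresh a}) &
      (forall v, v \in fresh a -> exists2 f, f \in add a & v \in f.2)].

Definition wf_dms (sch : schema) (S : dms) : Prop :=
  (forall r, r \in init S -> r < size sch /\ arity sch r = 0) /\
  (forall a, a \in acts S -> wf_action sch a).

Fixpoint wf_mso (sch : schema) (f : mso) : Prop :=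
  match f with
  | MAt q _ => wf_fol sch q
  | MLt _ _ | MIn _ _ => True
  | MNot f => wf_mso sch f
  | MAnd f1 f2 => wf_mso sch f1 /\ wf_mso sch f2
  | MEx1 _ f | MEx2 _ f | MExG _ f => wf_mso sch f
  end.

Fixpoint mfv1 (f : mso) : seq nat :=
  match f with
  | MAt _ x => [:: x]
  | MLt x y => [:: x; y]
  | MIn x _ => [:: x]
  | MNot f => mfv1 f
  | MAnd f1 f2 => mfv1 f1 ++ mfv1 f2
  | MEx1 x f => [seq y <- mfv1 f | y != x]
  | MEx2 _ f | MExG _ f => mfv1 f
  end.

Fixpoint mfv2 (f : mso) : seq nat :=
  match f with
  | MAt _ _ | MLt _ _ => [::]
  | MIn _ X => [:: X]
  | MNot f => mfv2 f
  | MAnd f1 f2 => mfv2 f1 ++ mfv2 f2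
  | MEx2 X f => [seq Y <- mfv2 f | Y != X]
  | MEx1 _ f | MExG _ f => mfv2 f
  end.

Fixpoint mfvd (f : mso) : seq nat :=
  match f with
  | MAt q _ => fv q
  | MLt _ _ | MIn _ _ => [::]
  | MNot f => mfvd f
  | MAnd f1 f2 => mfvd f1 ++ mfvd f2
  | MExG u f => [seq w <- mfvd f | w != u]
  | MEx1 _ f | MEx2 _ f => mfvd f
  end.

Definition sentence (f : mso) : Prop :=
  [/\ mfv1 f = [::], mfv2 f = [::] & mfvd f = [::]].

Definition inst := {fset fact}.

Definition in_adom (I : inst) (e : nat) : Prop :=
  exists2 f, f \in I & e \in f.2.

Definition upd {T : Type} (s : nat -> T) (u : nat) (e : T) : nat -> T :=
  fun w => if w == u then e else s w.

Fixpoint sat (I : inst) (s : nat -> nat) (q : fol) : Prop :=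
  match q with
  | FTrue => True
  | FAtom r a => (r, map s a) \in I
  | FEq u v => s u = s v
  | FNot q => ~ sat I s q
  | FAnd q1 q2 => sat I s q1 /\ sat I s q2
  | FEx u q => exists e, in_adom I e /\ sat (I) (upd s u e) q
  end.

Definition subst_inst (s : nat -> nat) (J : seq fact) : inst :=
  [fset ((f.1, map s f.2) : fact) | f in J].

Definition init_inst (S : dms) : inst :=
  [fset ((r, [::]) : fact) | r in init S].

Definition step (S : dms) (I : inst) (H : {fset nat}) (I' : inst)
    (H' : {fset nat}) : Prop :=
  exists2 a, a \in acts S & exists s : nat -> nat,
    [/\ (forall u, u \in params a -> in_adom I (s u)),
        (forall v, v \in fresh a -> s v \notin H),
        {in fresh a &, injective s} /\ sat I s (guard a),
        I' = (I `\` subst_inst s (del a)) `|` subst_inst s (add a) &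
        H' = H `|` [fset s v | v in fresh a]].

Definition is_run (S : dms) (rho : nat -> inst) : Prop :=
  rho 0 = init_inst S /\
  exists Hs : nat -> {fset nat},
    Hs 0 = fset0 /\ forall i, step S (rho i) (Hs i) (rho i.+1) (Hs i.+1).

Fixpoint msat (rho : nat -> inst) (px : nat -> nat) (pX : nat -> nat -> Prop)
    (pd : nat -> nat) (f : mso) : Prop :=
  match f with
  | MAt q x =>
      (forall u, u \in fv q -> in_adom (rho (px x)) (pd u)) /\
      sat (rho (px x)) pd q
  | MLt x y => px x < px y
  | MIn x X => pX X (px x)
  | MNot f => ~ msat rho px pX pd f
  | MAnd f1 f2 => msat rho px pX pd f1 /\ msat rho px pX pd f2
  | MEx1 x f => exists i, msat rho (upd px x i) pX pd f
  | MEx2 X f => exists P : nat -> Prop, msat rho px (upd pX X P) pd f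
  | MExG u f =>
      exists e, (exists i, in_adom (rho i) e) /\ msat rho px pX (upd pd u e) f
  end.

(* rho |= phi for a sentence (assignments irrelevant for sentences) *)
Definition models (rho : nat -> inst) (f : mso) : Prop :=
  msat rho (fun _ => 0) (fun _ _ => False) (fun _ => 0) f.

Definition mc_input := (schema * dms * mso)%type.

Definition mc_wf (x : mc_input) : Prop :=
  let: (sch, D, phi) := x in [/\ wf_dms sch D, wf_mso sch phi & sentence phi].

Definition mc_yes (x : mc_input) : Prop :=
  let: (sch, D, phi) := x in forall rho, is_run D rho -> models rho phi.

(* Model of computation: Minsky counter (register) machines.                *)

Inductive instr : Type :=
| Inc of nat
| Dec of nat & nat.

Definition program := seq instr.
Definition mconfig := (nat * (nat -> nat))%type.

Definition mstep (p : program) (c : mconfig) : mconfig :=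
  let: (pc, R) := c in
  if pc < size p then
    match nth (Inc 0) p pc with
    | Inc r => (pc.+1, upd R r (R r).+1)
    | Dec r j => if R r == 0 then (j, R) else (pc.+1, upd R r (R r).-1)
    end
  else c.

Definition halted (p : program) (c : mconfig) : bool := size p <= c.1.

Definition mexec (p : program) (n : nat) (c : mconfig) : mconfig :=
  iter n (mstep p) c.

Definition minit (k : nat) : mconfig := (0, upd (fun _ => 0) 0 k).

Definition decides {T : countType} (p : program) (D P : T -> Prop) : Prop :=
  forall x, D x -> exists n,
    let c := mexec p n (minit (choice.pickle x)) in
    halted p c /\ ((c.2 0 = 1 /\ P x) \/ (c.2 0 = 0 /\ ~ P x)).

Definition undecidable {T : countType} (D P : T -> Prop) : Prop :=
  ~ exists p : program, decides p D P.

(* Main.v *)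
Require Import Defs.
From HB Require Import structures.
From Stdlib Require Import FunctionalExtensionality IndefiniteDescription.
From mathcomp Require Import all_boot.
From mathcomp Require Import finmap.

Set Implicit Arguments.
Unset Strict Implicit.
Unset Printing Implicit Defensive.

(** Suppose that a counter machine [p] decides the problem. A DMS simulates a
    counter machine [q] by keeping register [r] as the cardinality of a unary
    relation; before the simulation it loads an arbitrary number of elements
    into register 0, and a sentence [phi_m], obtained by applying [m] times a
    "next position" context to a fixed formula, says that no halting state is
    reached when this load phase has length [m]. So the instance
    [(sch, D_q, phi_m)] is positive iff [q] diverges on input [m].

    Since [phi_m] is an iterated context, its code is computable from [m] by a
    counter machine, and the code of [((sch, D_q), phi_m)] depends on [(sch, D_q)]
    only through the code of that pair. Let [q] on input [m] compute the code of
    the pair of [m] and [phi_m], run [p] on it, and halt iff [p] accepts. For [m]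
    the code of [(sch, D_q)] itself, [p] is run on the instance which asserts
    that this very computation diverges. *)

(** * Counter machines *)

Definition reaches (p : program) (c c' : mconfig) : Prop :=
  exists n, mexec p n c = c'.

Lemma reaches_refl p c : reaches p c c.
Proof. by exists 0. Qed.

Lemma reaches_trans p c1 c2 c3 :
  reaches p c1 c2 -> reaches p c2 c3 -> reaches p c1 c3.
Proof. by move=> [n <-] [k <-]; exists (k + n); rewrite /mexec iterD. Qed.

Lemma reaches_step p c c' : mstep p c = c' -> reaches p c c'.
Proof. by move=> <-; exists 1. Qed.

Lemma mexec_fixed p c n : mstep p c = c -> mexec p n c = c.
Proof. by move=> fix_c; elim: n => //= n ->. Qed.

Lemma mstep_halted p c : halted p c -> mstep p c = c.
Proof. by case: c => pc R; rewrite /halted /= ltnNge => ->. Qed.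

(** Halting configurations are fixed points too, so a halt before [c'] would make [c'] halted; after
    [c'] nothing changes. *)
Lemma reaches_fixed_nonhalting p c c' :
    reaches p c c' -> mstep p c' = c' -> ~~ halted p c' ->
  forall n, ~~ halted p (mexec p n c).
Proof.
move=> [k c'E] fix_c' nhalt n; apply: contra nhalt => halt_n.
have [le_kn|/ltnW le_nk] := leqP k n.
  move: halt_n; rewrite -(subnK le_kn) /mexec iterD.
  by rewrite -/(mexec p k c) c'E -/(mexec _ _ _) mexec_fixed.
rewrite -c'E -(subnK le_nk) /mexec iterD -/(mexec p n c) -/(mexec p _ _).
by rewrite mexec_fixed // mstep_halted.
Qed.

(* Jumps beyond the end of [p] all halt, so they are redirected to the single
   exit [o + size p]. *)
Definition relocate (o N : nat) (i : instr) : instr :=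
  match i with
  | Inc r => Inc r
  | Dec r j => Dec r (o + minn j N)
  end.

(** A step of [p] is matched by one step of the copy, or by none once [p] has halted. Clamping the
    program counter in [exit] agrees with the clamped jump targets. *)
Lemma relocate_reaches (l1 p l2 : program) c n :
  let exit c := (size l1 + minn c.1 (size p), c.2) in
  reaches (l1 ++ map (relocate (size l1) (size p)) p ++ l2)
    (exit c) (exit (mexec p n c)).
Proof.
move=> exit; elim: n => [|n IHn]; first exact: reaches_refl.
apply: reaches_trans IHn _; rewrite /mexec iterS -/(mexec p n c).
case: (mexec p n c) => pc R; rewrite /exit.
have [lt_pc|ge_pc] := ltnP pc (size p); last first.
  by rewrite mstep_halted // (minn_idPr ge_pc); apply: reaches_refl.
apply: reaches_step; rewrite /mstep !size_cat size_map.
rewrite ltn_add2l ltn_addr // nth_cat ltnNge leq_addr /= addKn.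
rewrite nth_cat size_map lt_pc (nth_map (Inc 0)) //.
case: (nth (Inc 0) p pc) => [r|r j] /=; first by rewrite (minn_idPl lt_pc) addnS.
by case: eqP => //= _; rewrite (minn_idPl lt_pc) addnS.
Qed.

(** * A structured loop language compiled to counter machines *)

Inductive com : Type :=
| CSkip
| CInc of nat
| CSeq of com & com
| CLoop of nat & com.

(* Register [z] is kept at zero, which makes [Dec z o] an unconditional jump. *)
Fixpoint compile (z : nat) (c : com) (o : nat) : program :=
  match c with
  | CSkip => [::]
  | CInc r => [:: Inc r]
  | CSeq c1 c2 =>
      let p1 := compile z c1 o in p1 ++ compile z c2 (o + size p1)
  | CLoop r c1 =>
      let p1 := compile z c1 o.+1 in
      Dec r (o + size p1).+2 :: rcons p1 (Dec z o)
  end.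

Inductive exec (z : nat) : com -> (nat -> nat) -> (nat -> nat) -> Prop :=
| ExecSkip s : exec z CSkip s s
| ExecInc r s : exec z (CInc r) s (upd s r (s r).+1)
| ExecSeq c1 c2 s1 s2 s3 :
    exec z c1 s1 s2 -> exec z c2 s2 s3 -> exec z (CSeq c1 c2) s1 s3
| ExecLoop0 r c s : s r = 0 -> exec z (CLoop r c) s s
| ExecLoopS r c k s1 s2 s3 :
    s1 r = k.+1 -> exec z c (upd s1 r k) s2 -> s2 z = 0 ->
    exec z (CLoop r c) s2 s3 -> exec z (CLoop r c) s1 s3.

(** Jump targets are absolute, hence the offset [size l1]; the code on both sides is arbitrary so
    that the induction reaches subprograms. *)
Lemma compile_reaches z c s s' : exec z c s s' ->
  forall l1 l2, let p := compile z c (size l1) in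
  reaches (l1 ++ p ++ l2) (size l1, s) (size l1 + size p, s').
Proof.
elim=> {c s s'} [s|r s|c1 c2 s1 s2 s3 _ IH1 _ IH2|r c s s0
    |r c k s1 s2 s3 s1E _ IH1 s2z _ IH2] l1 l2 /=.
- by rewrite addn0; exact: reaches_refl.
- apply: reaches_step; rewrite /mstep size_cat /= -addn1 leq_add2l /=.
  by rewrite nth_cat ltnn subnn /= addn1.
- rewrite size_cat -catA; apply: reaches_trans (IH1 _ _) _.
  have := IH2 (l1 ++ compile z c1 (size l1)) l2.
  by rewrite /= !size_cat -!catA !addnA.
- apply: reaches_step; rewrite /mstep size_cat /= -addn1 leq_add2l /=.
  by rewrite nth_cat ltnn subnn /= s0 /= size_rcons !addnS.
- set p1 := compile z c (size l1).+1.
  apply: reaches_trans (_ : reaches _ _ ((size l1).+1, upd s1 r k)) _.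
    apply: reaches_step; rewrite /mstep size_cat /= -addn1 leq_add2l /=.
    by rewrite nth_cat ltnn subnn /= s1E /= addn1.
  (* For the body, the loop test joins the left context and the back jump joins the right one. *)
  have := IH1 (rcons l1 (Dec r (size l1 + size p1).+2)) (Dec z (size l1) :: l2).
  rewrite /= size_rcons -/p1 cat_rcons => IH1'.
  have := IH2 l1 l2; rewrite /= -/p1 cat_rcons => IH2'.
  apply: reaches_trans IH1' _; apply: reaches_trans IH2'.
  apply: reaches_step; rewrite addSnnS /mstep !size_cat /= size_cat /=.
  rewrite ltn_add2l ltnS -[X in X < _]addn0 ltn_add2l /=.
  by rewrite nth_cat ltnNge leq_addr /= addKn /= nth_cat ltnn subnn /= s2z.
Qed.

(** * Computing the code of an iterated context *)

(** Register files are written [nth 0 l]: every register past the end of [l] reads 0, as register 6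
    does below. *)
Lemma upd_nth (l : seq nat) r v :
  upd (nth 0 l) r v = nth 0 (set_nth 0 l r v).
Proof.
by apply: functional_extensionality => i; rewrite nth_set_nth.
Qed.

Lemma minit_nth k n : minit k = (0, nth 0 (k :: nseq n 0)).
Proof.
congr pair; apply: functional_extensionality => -[|i] //=.
by rewrite /upd nth_nseq if_same.
Qed.

Lemma exec_inc z r l s :
  s = nth 0 (set_nth 0 l r (nth 0 l r).+1) -> exec z (CInc r) (nth 0 l) s.
Proof. by move=> ->; rewrite -upd_nth; constructor. Qed.

(** [G k j] is the register file with [k] passes left and [j] passes done. *)
Lemma exec_loop z r c (G : nat -> nat -> seq nat) n :
    (forall k j, nth 0 (G k j) r = k) -> (forall k j, nth 0 (G k j) z = 0) ->
    (forall k j, exec z c (nth 0 (set_nth 0 (G k.+1 j) r k))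
                          (nth 0 (G k j.+1))) ->
  exec z (CLoop r c) (nth 0 (G n 0)) (nth 0 (G 0 n)).
Proof.
move=> Gr Gz body.
suff gen j : exec z (CLoop r c) (nth 0 (G n j)) (nth 0 (G 0 (n + j))).
  by have := gen 0; rewrite addn0.
elim: n j => [|n IHn] j.
  by apply: ExecLoop0; apply: Gr.
rewrite addSnnS; apply: ExecLoopS (Gr _ _) _ (Gz _ _) (IHn j.+1).
by rewrite upd_nth.
Qed.

(* Registers of the code generator: 0 holds the input and later the output, 1
   the accumulator, 2 is scratch space, 3, 4 and 5 hold copies of the input, and
   6 is the register that stays zero. *)
Definition double (r : nat) : com :=
  CSeq (CLoop r (CSeq (CInc 2) (CInc 2))) (CLoop 2 (CInc r)).

Lemma exec_double1 x a b c d :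
  exec 6 (double 1) (nth 0 [:: x; a; 0; b; c; d])
                    (nth 0 [:: x; a.*2; 0; b; c; d]).
Proof.
apply: (@ExecSeq _ _ _ _ (nth 0 [:: x; 0; a.*2; b; c; d])).
  apply: (@exec_loop _ _ _ (fun k j => [:: x; k; j.*2; b; c; d])) => //= k j.
  by apply: ExecSeq (exec_inc _ erefl) _; apply: exec_inc.
apply: (@exec_loop _ _ _ (fun k j => [:: x; j; k; b; c; d])) => //= k j.
exact: exec_inc.
Qed.

Lemma exec_double0 x a b c d :
  exec 6 (double 0) (nth 0 [:: x; a; 0; b; c; d])
                    (nth 0 [:: x.*2; a; 0; b; c; d]).
Proof.
apply: (@ExecSeq _ _ _ _ (nth 0 [:: 0; a; x.*2; b; c; d])).
  apply: (@exec_loop _ _ _ (fun k j => [:: k; a; j.*2; b; c; d])) => //= k j.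
  by apply: ExecSeq (exec_inc _ erefl) _; apply: exec_inc.
apply: (@exec_loop _ _ _ (fun k j => [:: j; a; k; b; c; d])) => //= k j.
exact: exec_inc.
Qed.

Definition push (n : nat) : com :=
  CSeq (double 1) (CSeq (CInc 1) (iter n (CSeq (double 1)) CSkip)).

(** The last entry is pushed first, following the right fold in [CodeSeq.code]. *)
Definition push_seq (s : seq nat) : com :=
  foldr (fun n c => CSeq c (push n)) CSkip s.

(** This is [CodeSeq.code] started from [a] instead of 0, so that concatenation becomes
    composition. *)
Definition code_onto (a : nat) (s : seq nat) : nat :=
  foldr (fun n m => 2 ^ n * m.*2.+1) a s.

Lemma exec_push n x a b c d :
  exec 6 (push n) (nth 0 [:: x; a; 0; b; c; d])
                  (nth 0 [:: x; 2 ^ n * a.*2.+1; 0; b; c; d]).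
Proof.
apply: ExecSeq (exec_double1 _ _ _ _ _) (ExecSeq (exec_inc _ erefl) _) => /=.
elim: n (a.*2.+1) => [|n IHn] e /=; first by rewrite mul1n; constructor.
apply: ExecSeq (exec_double1 _ _ _ _ _) _.
by rewrite expnSr -mulnA mul2n; apply: IHn.
Qed.

Lemma exec_push_seq s x a b c d :
  exec 6 (push_seq s) (nth 0 [:: x; a; 0; b; c; d])
                      (nth 0 [:: x; code_onto a s; 0; b; c; d]).
Proof.
elim: s => [|n s IHs] /=; first by constructor.
exact: ExecSeq IHs (exec_push _ _ _ _ _ _).
Qed.

Lemma code_onto_cat a s t : code_onto a (s ++ t) = code_onto (code_onto a t) s.
Proof. exact: foldr_cat. Qed.

Lemma code_onto_nseq a n s :
  code_onto a (flatten (nseq n s)) = iter n (code_onto^~ s) a.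
Proof. by elim: n => //= n <-; rewrite code_onto_cat. Qed.

Section CodeGenerator.

Variables A0 A1 A2 A3 A4 : seq nat.

Definition iterated_list (n : nat) : seq nat :=
  A0 ++ flatten (nseq n A1) ++ A2 ++ flatten (nseq n A3) ++ A4.

(** The code of a pair is that of the list of the codes of its components; [n] stands for the code
    of the first one. *)
Definition diagonal_code (n : nat) : nat :=
  CodeSeq.code [:: n; CodeSeq.code (iterated_list n)].

(** The list is coded from its right end. The three copies of the input drive the repetitions of
    [A3], those of [A1], and the final multiplication by [2 ^ n]. *)
Definition generator : com :=
  foldr CSeq CSkip
    [:: CLoop 0 (CSeq (CInc 3) (CSeq (CInc 4) (CInc 5)));
        push_seq A4; CLoop 3 (push_seq A3);
        push_seq A2; CLoop 4 (push_seq A1); push_seq A0;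
        CInc 0; CLoop 1 (double 0); double 0; CInc 0; CLoop 5 (double 0)].

Lemma exec_generator n :
  exec 6 generator (nth 0 [:: n; 0; 0; 0; 0; 0])
                   (nth 0 [:: diagonal_code n; 0; 0; 0; 0; 0]).
Proof.
apply: (@ExecSeq _ _ _ _ (nth 0 [:: 0; 0; 0; n; n; n])).
  apply: (@exec_loop _ _ _ (fun k j => [:: k; 0; 0; j; j; j])) => //= k j.
  by do 2!(apply: ExecSeq (exec_inc _ erefl) _); apply: exec_inc.
apply: ExecSeq (exec_push_seq _ _ _ _ _ _) _.
set a4 := code_onto 0 A4.
apply: (@ExecSeq _ _ _ _ (nth 0 [:: 0; iter n (code_onto^~ A3) a4; 0; 0; n; n])).
  apply: (@exec_loop _ _ _
    (fun k j => [:: 0; iter j (code_onto^~ A3) a4; 0; k; n; n])) => //= k j.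
  exact: exec_push_seq.
apply: ExecSeq (exec_push_seq _ _ _ _ _ _) _.
set a2 := code_onto _ A2.
apply: (@ExecSeq _ _ _ _ (nth 0 [:: 0; iter n (code_onto^~ A1) a2; 0; 0; 0; n])).
  apply: (@exec_loop _ _ _
    (fun k j => [:: 0; iter j (code_onto^~ A1) a2; 0; 0; k; n])) => //= k j.
  exact: exec_push_seq.
apply: ExecSeq (exec_push_seq _ _ _ _ _ _) _.
set a0 := code_onto _ A0.
have a0E : a0 = CodeSeq.code (iterated_list n).
  rewrite /CodeSeq.code -/(code_onto 0 _) /iterated_list !code_onto_cat.
  by rewrite !code_onto_nseq.
(* With the list coded as [a0], it remains to build [2 ^ n * (2 ^ a0).*2.+1], the code of the
   two-element list. *)
apply: ExecSeq (exec_inc _ erefl) _ => /=.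
apply: (@ExecSeq _ _ _ _ (nth 0 [:: 2 ^ a0; 0; 0; 0; 0; n])).
  apply: (@exec_loop _ _ _ (fun k j => [:: 2 ^ j; k; 0; 0; 0; n])) => //= k j.
  by rewrite expnS mul2n; apply: exec_double0.
apply: ExecSeq (exec_double0 _ _ _ _ _) (ExecSeq (exec_inc _ erefl) _) => /=.
set b := _.*2.+1.
apply: ExecSeq (ExecSkip _ _).
have -> : diagonal_code n = 2 ^ n * b by rewrite /diagonal_code -a0E /= muln1.
rewrite -{1}[b]mul1n.
apply: (@exec_loop _ _ _ (fun k j => [:: 2 ^ j * b; 0; 0; 0; 0; k])) => //= k j.
by rewrite expnS -mulnA mul2n; apply: exec_double0.
Qed.

End CodeGenerator.

(** * Running a decider on a generated code *)

(* Halts iff the answer of [p] is nonzero: a zero answer makes the last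
   instruction jump to itself. *)
Definition flip (pre p : program) : program :=
  let o := size pre in
  pre ++ map (relocate o (size p)) p ++ [:: Dec 0 (o + size p)].

(** The generator leaves every register but 0 at zero, so [p] starts exactly from its initial
    configuration. *)
Lemma flip_reaches A0 A1 A2 A3 A4 p k n :
    let c := mexec p n (minit (diagonal_code A0 A1 A2 A3 A4 k)) in
    let pre := compile 6 (generator A0 A1 A2 A3 A4) 0 in
    halted p c ->
  reaches (flip pre p) (minit k) (size pre + size p, c.2).
Proof.
move=> c pre halt_c.
have := @compile_reaches _ _ _ _ (exec_generator A0 A1 A2 A3 A4 k) [::]
  (map (relocate (size pre) (size p)) p ++ [:: Dec 0 (size pre + size p)]).
rewrite /= -/pre -/(flip pre p) -(minit_nth k 5) => reach1.
apply: reaches_trans reach1 _.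
have := @relocate_reaches pre p [:: Dec 0 (size pre + size p)]
  (minit (diagonal_code A0 A1 A2 A3 A4 k)) n.
cbv beta zeta; rewrite -/c (minn_idPr halt_c) (minit_nth _ 5) min0n addn0 => reach2.
exact: reach2.
Qed.

Lemma flip_last pre p R : let pc := size pre + size p in
  mstep (flip pre p) (pc, R) = if R 0 == 0 then (pc, R) else (pc.+1, upd R 0 (R 0).-1).
Proof.
rewrite /= /flip !size_cat size_map /= !addnA addn1 ltnSn catA.
by rewrite nth_cat size_cat size_map ltnn subnn.
Qed.

Lemma size_flip pre p : size (flip pre p) = (size pre + size p).+1.
Proof. by rewrite /flip !size_cat size_map /= addn1 addnS. Qed.

(** Since [q] is chosen before [k], the input can later be a code built from [q] itself. *)
Lemma diagonal_program A0 A1 A2 A3 A4 p : exists q, forall k n,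
  let c := mexec p n (minit (diagonal_code A0 A1 A2 A3 A4 k)) in
  halted p c ->
  (c.2 0 != 0 -> exists j, halted q (mexec q j (minit k))) /\
  (c.2 0 = 0 -> forall j, ~~ halted q (mexec q j (minit k))).
Proof.
have [pre reach] : exists pre, forall k n,
    let c := mexec p n (minit (diagonal_code A0 A1 A2 A3 A4 k)) in
    halted p c ->
    reaches (flip pre p) (minit k) (size pre + size p, c.2).
  exists (compile 6 (generator A0 A1 A2 A3 A4) 0); exact: flip_reaches.
exists (flip pre p) => k n c /reach reach_c.
have last_step := flip_last pre p c.2; split=> [/negPf|] c0.
  cbv zeta in last_step; rewrite c0 in last_step.
  have [j jE] := reaches_trans reach_c (reaches_step last_step).
  by exists j; rewrite jE /halted size_flip.
cbv zeta in last_step; rewrite c0 eqxx in last_step.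
by apply: reaches_fixed_nonhalting reach_c last_step _; rewrite /halted size_flip ltnn.
Qed.

Local Open Scope fset_scope.

(** * Counter automata as database-manipulating systems *)

(** The two branches of [Dec] become separate operations, because an action has one guard and one
    effect. *)
Inductive op : Type :=
| OInc of nat
| ODec of nat
| OZero of nat
| ONop.

Definition op_enc (o : op) : option (nat * nat) :=
  match o with
  | OInc r => Some (0, r)
  | ODec r => Some (1, r)
  | OZero r => Some (2, r)
  | ONop => None
  end.

Definition op_dec (x : option (nat * nat)) : op :=
  match x with
  | Some (0, r) => OInc r
  | Some (1, r) => ODec r
  | Some (_, r) => OZero r
  | None => ONop
  end.

Lemma op_encK : cancel op_enc op_dec. Proof. by case. Qed.

HB.instance Definition _ := Equality.copy op (can_type op_encK).

Definition op_sem (o : op) (R R' : nat -> nat) : Prop :=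
  match o with
  | OInc r => R' = upd R r (R r).+1
  | ODec r => 0 < R r /\ R' = upd R r (R r).-1
  | OZero r => R r = 0 /\ R' = R
  | ONop => R' = R
  end.

(* Control state [s] is the nullary relation [s.*2]; register [r] is the unary
   relation [r.*2.+1], and its value is the cardinality of that relation. *)
Definition act_of (t : nat * op * nat) : action :=
  let: (s, o, s') := t in
  let src := (s.*2, [::]) in
  let tgt := (s'.*2, [::]) in
  match o with
  | OInc r =>
      Action [::] [:: 0] (FAtom s.*2 [::]) [:: src] [:: tgt; (r.*2.+1, [:: 0])]
  | ODec r =>
      Action [:: 0] [::] (FAnd (FAtom s.*2 [::]) (FAtom r.*2.+1 [:: 0]))
        [:: src; (r.*2.+1, [:: 0])] [:: tgt]
  | OZero r =>
      Action [::] [::]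
        (FAnd (FAtom s.*2 [::]) (FNot (FEx 0 (FAtom r.*2.+1 [:: 0]))))
        [:: src] [:: tgt]
  | ONop => Action [::] [::] (FAtom s.*2 [::]) [:: src] [:: tgt]
  end.

Definition automaton_dms (ts : seq (nat * op * nat)) : dms :=
  DMS [:: 0] (map act_of ts).

Definition state_facts (s : nat) (c : nat -> {fset nat}) (f : fact) : bool :=
  match f with
  | (k, [::]) => k == s.*2
  | (k, [:: e]) => odd k && (e \in c k./2)
  | _ => false
  end.

(** Only the cardinalities of the sets [c r] matter. Keeping them inside the history makes a fresh
    value new to its register, so that an increment adds exactly one. *)
Definition encodes (I : inst) (H : {fset nat}) (s : nat) (R : nat -> nat) :=
  exists c : nat -> {fset nat},
    [/\ forall f, (f \in I) = state_facts s c f, forall r, #|` c r| = R r &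
        forall r, c r `<=` H].

Lemma in_subst_inst s (J : seq fact) f :
  (f \in subst_inst s J) = (f \in [seq (g.1, map s g.2) | g <- J]).
Proof. by apply/imfsetP/mapP => -[g]; exists g. Qed.

Definition nullary_at (I : inst) (s : nat) : bool := (s.*2, [::]) \in I.

Lemma encodes_nullary I H s R k :
  encodes I H s R -> nullary_at I k = (k == s).
Proof. by rewrite /nullary_at; case=> c [-> _ _]; rewrite /= (inj_eq double_inj). Qed.

Lemma encodes_init ts :
  encodes (init_inst (automaton_dms ts)) fset0 0 (fun=> 0).
Proof.
exists (fun=> fset0); split=> [f|r|r]; rewrite ?cardfs0 ?fsub0set //.
apply/imfsetP/idP => [[r /=]|].
  by rewrite inE => /eqP -> ->.
by case: f => k [|e [|]] //=; [move/eqP->; exists 0; rewrite ?inE | rewrite andbF].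
Qed.

Definition after (x : nat -> nat) (a : action) (I : inst) : inst :=
  (I `\` subst_inst x (del a)) `|` subst_inst x (add a).

Definition history (x : nat -> nat) (a : action) (H : {fset nat}) :
    {fset nat} :=
  H `|` [fset x v | v in fresh a].

Lemma in_after x a I f :
  (f \in after x a I) =
  (f \in I) && (f \notin [seq (g.1, map x g.2) | g <- del a]) ||
  (f \in [seq (g.1, map x g.2) | g <- add a]).
Proof. by rewrite in_fsetU in_fsetD !in_subst_inst andbC. Qed.

Lemma sub_history x a H : H `<=` history x a H.
Proof. exact: fsubsetUl. Qed.

Lemma eq_doubleS k r : (k == r.*2.+1) = odd k && (k./2 == r).
Proof.
apply/eqP/andP => [->|[odd_k /eqP <-]]; first by rewrite /= odd_double uphalf_double.
by rewrite -[LHS]odd_double_half odd_k.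
Qed.

Lemma encodes_move x H' I H s R a s' :
    encodes I H s R -> H `<=` H' ->
    del a = [:: (s.*2, [::])] -> add a = [:: (s'.*2, [::])] ->
  encodes (after x a I) H' s' R.
Proof.
case=> c [Ic cardc subc] subH dela adda; exists c; split=> [[k args]||r] //.
  rewrite in_after dela adda Ic /=.
  case: args => [|e [|e' l]] //=; rewrite !inE !xpair_eqE /= ?andbT ?andbF ?orbF /= ?andbT //.
  (* The only nullary fact of [I] is the deleted one; as deletion precedes addition, this also
     covers [s' = s]. *)
  by rewrite andbN.
exact: fsubset_trans (subc r) subH.
Qed.

Lemma encodes_inc x I H s R r s' (a := act_of (s, OInc r, s')) :
    encodes I H s R -> x 0 \notin H ->
  encodes (after x a I) (history x a H) s' (upd R r (R r).+1).
Proof.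
case=> c [Ic cardc subc] x0H; exists (upd c r (x 0 |` c r)).
split=> [[k args]|k|k].
- rewrite in_after Ic /=.
  case: args => [|e [|e' l]] //=;
    rewrite !inE !xpair_eqE /= ?andbT ?andbF ?orbF /= ?andbT //.
  - by rewrite andbN.
  - rewrite eqseq_cons andbT eq_doubleS /upd.
    by case: (odd k) => //=; have [->|_] := eqVneq k./2 r; rewrite ?orbF // !inE orbC.
  - by rewrite eqseq_cons !andbF.
- rewrite /upd; case: eqP => // _; rewrite cardfsU1 cardc.
  by rewrite (contra _ x0H) //; apply: fsubsetP.
- rewrite /upd; case: eqP => _; last exact: fsubset_trans (subc k) (sub_history _ _ _).
  rewrite fsubUset fsub1set (fsubset_trans (subc r) (sub_history _ _ _)) andbT.
  by rewrite inE; apply/orP; right; apply/imfsetP; exists 0; rewrite ?inE.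
Qed.

Lemma encodes_dec x I H s R r s' (a := act_of (s, ODec r, s')) :
    encodes I H s R -> (r.*2.+1, [:: x 0]) \in I ->
  0 < R r /\ encodes (after x a I) (history x a H) s' (upd R r (R r).-1).
Proof.
case=> c [Ic cardc subc]; rewrite Ic /= odd_double uphalf_double /= => x0c.
have Rr : R r = (#|` c r `\ x 0|).+1 by rewrite -cardc (cardfsD1 (x 0)) x0c.
split; first by rewrite Rr.
exists (upd c r (c r `\ x 0)); split=> [[k args]|k|k].
- rewrite in_after Ic /=.
  case: args => [|e [|e' l]] //=;
    rewrite !inE !xpair_eqE /= ?andbT ?andbF ?orbF /= ?andbT //.
  - by rewrite andbN.
  - rewrite eqseq_cons andbT eq_doubleS /upd.
    by case: (odd k) => //=; have [->|_] := eqVneq k./2 r; rewrite ?andbT // !inE andbC.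
- by rewrite /upd; case: eqP => // _; rewrite Rr.
- apply: fsubset_trans (sub_history _ _ _); rewrite /upd; case: eqP => // _.
  exact: fsubset_trans (fsubD1set _ _) (subc r).
Qed.

(** The form with [in_adom] serves both the parameter of a decrement and the active-domain
    quantifier of the zero test. *)
Lemma encodes_regP I H s R r : encodes I H s R ->
  0 < R r <-> exists2 e, in_adom I e & (r.*2.+1, [:: e]) \in I.
Proof.
case=> c [Ic cardc _]; split.
  rewrite -cardc cardfs_gt0 => /fset0Pn[e ec].
  have eI : (r.*2.+1, [:: e]) \in I by rewrite Ic /= odd_double uphalf_double.
  by exists e => //; exists (r.*2.+1, [:: e]) => //; rewrite inE.
case=> e _; rewrite Ic /= odd_double uphalf_double /= => ec.
by rewrite -cardc cardfs_gt0; apply/fset0Pn; exists e.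
Qed.

Lemma step_sound (ts : seq (nat * op * nat)) I H I' H' s R :
    encodes I H s R -> step (automaton_dms ts) I H I' H' ->
  exists o s' R',
    [/\ (s, o, s') \in ts, op_sem o R R' & encodes I' H' s' R'].
Proof.
move=> enc [_ /mapP[[[t o] s'] ts_t ->]] [x].
rewrite -/(after x _ I) -/(history x _ H).
case=> _ xfresh [_ xguard] -> ->.
(* Every guard requires the state atom of [t], and the encoding makes only that of [s] true. *)
have t_s : t = s.
  apply/eqP; rewrite -(encodes_nullary _ enc).
  by case: o {ts_t xfresh} xguard => [r|r|r|] //= -[].
rewrite {t}t_s in ts_t xfresh xguard *.
case: o => [r|r|r|] in ts_t xfresh xguard *.
- exists (OInc r), s', (upd R r (R r).+1); split=> //.
  by apply: encodes_inc => //; apply: xfresh; rewrite inE.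
- have [Rr enc'] := encodes_dec s' enc (proj2 xguard).
  by exists (ODec r), s', (upd R r (R r).-1).
- exists (OZero r), s', R; split=> //.
    split=> //; apply/eqP; rewrite -leqn0 leqNgt; apply/negP.
    move=> /(encodes_regP _ enc)[e eI reI].
    by case: xguard => _ /= []; exists e.
  by apply: encodes_move enc _ _ _ => //; apply: sub_history.
- exists ONop, s', R; split=> //.
  by apply: encodes_move enc _ _ _ => //; apply: sub_history.
Qed.

Lemma fresh_value (H : {fset nat}) : exists e, e \notin H.
Proof.
exists (\max_(e <- H) e).+1; apply/negP => eH.
by have := leq_bigmax_seq (P := xpredT) (F := id) _ eH isT; rewrite ltnn.
Qed.

Lemma step_complete (ts : seq (nat * op * nat)) I H s R o s' R' :
    encodes I H s R -> (s, o, s') \in ts -> op_sem o R R' ->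
  exists I' H', step (automaton_dms ts) I H I' H' /\ encodes I' H' s' R'.
Proof.
move=> enc ts_t; set a := act_of (s, o, s').
have src : (s.*2, [::]) \in I by rewrite -/(nullary_at I s) (encodes_nullary _ enc).
(* A constant assignment suffices, as no action has more than one parameter or fresh variable. A
   decrement uses an element of the register, the others a value outside the history. *)
suff gen e : op_sem o R R' ->
    match o return Prop with
    | ODec r => in_adom I e /\ (r.*2.+1, [:: e]) \in I
    | _ => e \notin H
    end ->
    exists I' H', step (automaton_dms ts) I H I' H' /\ encodes I' H' s' R'.
  case: o => [r|r|r|] in ts_t a gen *; move=> osem;
    try by have [e eH] := fresh_value H; apply: gen eH.
  have [e eI reI] := (encodes_regP r enc).1 (proj1 osem).
  exact: gen osem (conj eI reI).
pose x (_ : nat) := e => osem oe.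
exists (after x a I), (history x a H); split.
  exists a; first exact: map_f.
  exists x; case: o => [r|r|r|] in ts_t a osem oe *; split=> //.
  - by split=> // u v; rewrite !inE => /eqP -> /eqP ->.
  - by move=> u _; case: oe.
  - by split=> //; split=> //=; case: oe.
  - split=> //; split=> //= -[d [dI rdI]].
    suff : 0 < R r by rewrite (proj1 osem).
    by apply/(encodes_regP r enc); exists d.
case: o => [r|r|r|] in ts_t a osem oe *.
- by rewrite osem; apply: encodes_inc.
- by rewrite (proj2 osem); apply: (encodes_dec s' enc _).2; case: oe.
- by rewrite (proj2 osem); apply: encodes_move enc _ _ _ => //; apply: sub_history.
- by rewrite osem; apply: encodes_move enc _ _ _ => //; apply: sub_history.
Qed.

Lemma run_exists (ts : seq (nat * op * nat)) (s : nat -> nat) (R : nat -> nat -> nat) :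
    s 0 = 0 -> R 0 = (fun=> 0) ->
    (forall i, exists2 o, (s i, o, s i.+1) \in ts & op_sem o (R i) (R i.+1)) ->
  exists2 rho, is_run (automaton_dms ts) rho &
    forall i, exists H, encodes (rho i) H (s i) (R i).
Proof.
move=> s0 R0 trans.
pose D := automaton_dms ts.
(* Each configuration carries its encoding proof, so that the successor choice can be iterated by
   dependent recursion. *)
pose T i := {x : inst * {fset nat} | encodes x.1 x.2 (s i) (R i)}.
have next i (x : T i) : {y : T i.+1 |
    step D (sval x).1 (sval x).2 (sval y).1 (sval y).2}.
  apply: constructive_indefinite_description.
  have [o ts_o o_sem] := trans i.
  have [I' [H' [st enc']]] := step_complete (svalP x) ts_o o_sem.
  by exists (exist _ (I', H') enc').
have enc0 : encodes (init_inst D) fset0 (s 0) (R 0).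
  by rewrite s0 R0; apply: encodes_init.
pose run := nat_rect T (exist _ (init_inst D, fset0) enc0) (fun i x => sval (next i x)).
exists (fun i => (sval (run i)).1).
  split=> //; exists (fun i => (sval (run i)).2); split=> // i.
  exact: svalP (next i (run i)).
by move=> i; exists (sval (run i)).2; apply: svalP (run i).
Qed.

(** * Well-formedness of the automaton systems *)

Definition op_regs (o : op) : seq nat :=
  match o with OInc r | ODec r | OZero r => [:: r] | ONop => [::] end.

Definition parity_schema (M : nat) : schema := mkseq (fun k => odd k : nat) M.*2.

Lemma wf_state M s : s < M -> wf_atom (parity_schema M) (s.*2, [::]).
Proof.
move=> ltsM; rewrite /wf_atom /arity size_mkseq ltn_double ltsM.
by rewrite nth_mkseq ?ltn_double //= odd_double.
Qed.

Lemma wf_reg M r u : r < M -> wf_atom (parity_schema M) (r.*2.+1, [:: u]).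
Proof.
move=> ltrM; have lt : r.*2.+1 < M.*2 by rewrite ltn_Sdouble.
by rewrite /wf_atom /arity size_mkseq lt nth_mkseq //= odd_double.
Qed.

Lemma wf_act_of M s o s' :
    s < M -> s' < M -> {in op_regs o, forall r, r < M} ->
  wf_action (parity_schema M) (act_of (s, o, s')).
Proof.
move=> /wf_state ws /wf_state ws' wr.
have wreg r u : r \in op_regs o -> wf_atom (parity_schema M) (r.*2.+1, [:: u]).
  by move=> /wr; apply: wf_reg.
have in1 r : r \in [:: r] by rewrite inE.
case: o {wr} wreg => [r|r|r|] wreg; split=> //=;
  do ?[by split | by move=> f; rewrite !inE => /eqP->].
- by move=> f; rewrite !inE => /orP[]/eqP->; split=> //; apply: wreg.
- by move=> v v0; exists (r.*2.+1, [:: 0]) => //; rewrite !inE eqxx orbT.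
- by split=> //; split=> //; apply: wreg.
- by move=> f; rewrite !inE => /orP[]/eqP->; split=> //; apply: wreg.
- by split=> //; split=> //; apply: wreg.
Qed.

Lemma wf_automaton_dms M ts :
    0 < M ->
    (forall t, t \in ts ->
       [/\ t.1.1 < M, t.2 < M & {in op_regs t.1.2, forall r, r < M}]) ->
  wf_dms (parity_schema M) (automaton_dms ts).
Proof.
move=> M0 wts; split=> [r|a].
  by rewrite inE => /eqP->; have [] := wf_state M0.
by move=> /mapP[[[s o] s'] /wts[ws ws' wr] ->]; apply: wf_act_of.
Qed.

Lemma automaton_bound (ts : seq (nat * op * nat)) : exists M, forall t, t \in ts ->
  [/\ t.1.1 < M, t.2 < M & {in op_regs t.1.2, forall r, r < M}].
Proof.
(* [op_regs] has at most one entry, so [sumn] returns that register, or 0. *)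
pose size_of (t : nat * op * nat) := maxn (maxn t.1.1 t.2) (sumn (op_regs t.1.2)).
exists (\max_(t <- ts) size_of t).+1 => t ts_t.
have := leq_bigmax_seq (P := xpredT) (F := size_of) t ts_t isT.
rewrite {1}/size_of !geq_max -andbA => /and3P[le1 le2 le_r]; split=> // r.
by case: t.1.2 le_r => [k|k|k|] //=; rewrite addn0 inE => le_k /eqP ->.
Qed.

(** * Simulating a counter machine *)

Section Simulation.

Variable q : program.

(* State 0 loads the input into register 0, state 1 is the halting state. *)
Definition st (pc : nat) : nat := if pc < size q then pc.+2 else 1.

Definition transitions_at (pc : nat) : seq (nat * op * nat) :=
  match nth (Inc 0) q pc with
  | Inc r => [:: (st pc, OInc r, st pc.+1)]
  | Dec r j => [:: (st pc, ODec r, st pc.+1); (st pc, OZero r, st j)]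
  end.

(** The load phase may stop at any length, which becomes the input. The loop at state 1 keeps halted
    runs infinite. *)
Definition transitions : seq (nat * op * nat) :=
  [:: (0, OInc 0, 0), (0, ONop, st 0), (1, ONop, 1)
    & flatten [seq transitions_at pc | pc <- iota 0 (size q)]].

Lemma st_gt0 pc : 0 < st pc. Proof. by rewrite /st; case: ifP. Qed.

Lemma transitionsP t : t \in transitions ->
  [\/ t = (0, OInc 0, 0), t = (0, ONop, st 0), t = (1, ONop, 1) |
      exists2 pc, pc < size q & t \in transitions_at pc].
Proof.
rewrite !inE => /or4P[/eqP->|/eqP->|/eqP->|/flattenP[l /mapP[pc + ->] t_pc]];
  [by constructor 1|by constructor 2|by constructor 3|].
by rewrite mem_iota => /andP[_ lt_pc]; constructor 4; exists pc.
Qed.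

Lemma transitions_load o s' :
  (0, o, s') \in transitions -> o = OInc 0 /\ s' = 0 \/ o = ONop /\ s' = st 0.
Proof.
move=> /transitionsP[[-> ->]|[-> ->]|//|[pc lt_pc]]; [by left|by right|].
rewrite /transitions_at /st lt_pc.
by case: (nth _ _ _) => [r|r j]; rewrite !inE.
Qed.

(** Outside state 0 the automaton is deterministic: [st] is injective on valid program counters, the
    tests on a register exclude each other, and all other counters collapse to state 1, where
    machine and automaton idle. *)
Lemma transitions_sound pc o s' R R' :
    (st pc, o, s') \in transitions -> op_sem o R R' ->
  s' = st (mstep q (pc, R)).1 /\ R' = (mstep q (pc, R)).2.
Proof.
have st0 := st_gt0 pc.
move=> /transitionsP[[s0]|[s0]|[s1 -> ->] /=|[pc' lt_pc']].
- by rewrite s0 in st0.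
- by rewrite s0 in st0.
- move: s1; rewrite {1}/st /mstep; case: ltnP => // ge_pc _ -> /=.
  by rewrite /st ltnNge ge_pc.
rewrite /transitions_at => t_pc'.
have pcE : pc = pc'.
  have: st pc = st pc'.
    by case: (nth _ _ _) t_pc' => [r|r j]; rewrite !inE; [|move=> /orP[]] => /eqP[].
  by rewrite /st lt_pc'; case: ifP => // _ [].
rewrite -{pc'}pcE in lt_pc' t_pc' *.
rewrite /mstep lt_pc'; case: (nth _ _ _) t_pc' => [r|r j]; rewrite !inE.
  by move=> /eqP[-> ->] /= ->.
move=> /orP[] /eqP[-> ->] /= [Rr ->]; last by rewrite Rr.
by rewrite gtn_eqF.
Qed.

Lemma transitions_complete pc R : exists2 o,
  (st pc, o, st (mstep q (pc, R)).1) \in transitions &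
  op_sem o R (mstep q (pc, R)).2.
Proof.
rewrite /mstep; have [lt_pc|ge_pc] := ltnP pc (size q); last first.
  by exists ONop => //; rewrite /st ltnNge ge_pc !inE eqxx !orbT.
have mem_at t : t \in transitions_at pc -> t \in transitions.
  move=> t_pc; rewrite !inE; apply/or4P; constructor 4.
  by apply/flattenP; exists (transitions_at pc); rewrite // map_f // mem_iota.
case E: (nth (Inc 0) q pc) => [r|r j].
  by exists (OInc r) => //; apply: mem_at; rewrite /transitions_at E inE.
have [R0|R_neq0] := eqVneq (R r) 0.
  by exists (OZero r) => //; apply: mem_at; rewrite /transitions_at E !inE eqxx orbT.
exists (ODec r); last by rewrite /= lt0n.
by apply: mem_at; rewrite /transitions_at E !inE eqxx.
Qed.

Lemma halting_run m n : halted q (mexec q n (minit m)) ->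
  exists2 rho, is_run (automaton_dms transitions) rho &
    [/\ nullary_at (rho m) 0, ~~ nullary_at (rho m.+1) 0 &
        exists i, nullary_at (rho i) 1].
Proof.
move=> halt_n.
(* The increments lead from position 0 to [m]; the idle transition then leads to [m.+1], where the
   machine starts. *)
pose c i := mexec q (i - m.+1) (minit m).
pose s i := if i <= m then 0 else st (c i).1.
pose R i := if i <= m then (minit i).2 else (c i).2.
have R0 : R 0 = fun=> 0.
  by apply: functional_extensionality => r; rewrite /R /= /upd if_same.
have trans i : exists2 o, (s i, o, s i.+1) \in transitions &
    op_sem o (R i) (R i.+1).
  rewrite /s /R; case: (ltngtP i m) => [lt_im|lt_mi|->].
  - exists (OInc 0); rewrite ?inE //=.
    by apply: functional_extensionality => r; rewrite /upd; case: (r == 0).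
  - have := transitions_complete (c i).1 (c i).2.
    rewrite -surjective_pairing.
    by rewrite /c (subSn lt_mi).
  - by exists ONop; rewrite /c subnn ?inE ?eqxx ?orbT.
have [rho rho_run enc] := run_exists (erefl : s 0 = 0) R0 trans.
exists rho => //; split.
- by have [H /encodes_nullary->] := enc m; rewrite /s leqnn.
- by have [H /encodes_nullary->] := enc m.+1; rewrite /s ltnn eq_sym -lt0n st_gt0.
- exists (n + m.+1)%N; have [H /encodes_nullary->] := enc (n + m.+1)%N.
  rewrite /s leqNgt ltn_addl // /c addnK /st ltnNge.
  by rewrite /halted in halt_n; rewrite halt_n.
Qed.

(** The two hypotheses on state 0 fix the load length as [m], so from position [m.+1] on the run can
    only simulate [q] on input [m]. *)
Lemma nonhalting_run m rho :
    (forall n, ~~ halted q (mexec q n (minit m))) ->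
    is_run (automaton_dms transitions) rho ->
    nullary_at (rho m) 0 -> ~~ nullary_at (rho m.+1) 0 ->
  forall i, ~~ nullary_at (rho i) 1.
Proof.
move=> nhalt [rho0 [Hs [Hs0 steps]]] load_m nload_Sm.
have load i : i <= m -> encodes (rho i) (Hs i) 0 (minit i).2.
  have state j : encodes (rho j) (Hs j) 0 (minit j).2 \/
      exists pc R, encodes (rho j) (Hs j) (st pc) R.
    elim: j => [|j [enc|[pc [R enc]]]].
    - left; rewrite rho0 Hs0.
      have -> : (minit 0).2 = fun=> 0.
        by apply: functional_extensionality => r; rewrite /= /upd if_same.
      exact: encodes_init.
    - have [o [s' [R' [/transitions_load[[-> ->]|[-> ->]] /= -> enc']]]] :=
        step_sound enc (steps j); last by right; exists 0, (minit j).2.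
      left; move: enc'; congr (encodes _ _ _ _).
      by apply: functional_extensionality => r; rewrite /upd; case: (r == 0).
    - have [o [s' [R' [t_in osem enc']]]] := step_sound enc (steps j).
      have [s'E _] := transitions_sound t_in osem; rewrite s'E in enc'.
      by right; exists (mstep q (pc, R)).1, R'.
  (* State 0 cannot be entered from a simulating state, as [st pc] is positive; hence loading at [m]
     propagates back to all earlier positions. *)
  have pred_load j : nullary_at (rho j.+1) 0 -> nullary_at (rho j) 0.
    have [enc _|[pc [R enc]]] := state j; first by rewrite (encodes_nullary _ enc).
    have [o [s' [R' [t_in osem enc']]]] := step_sound enc (steps j).
    have [s'E _] := transitions_sound t_in osem.
    by rewrite (encodes_nullary _ enc') s'E eq_sym gtn_eqF // st_gt0.
  move=> le_im; have load_i : nullary_at (rho i) 0.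
    elim: m le_im load_m {nhalt nload_Sm} => [|m IHm].
      by rewrite leqn0 => /eqP->.
    by rewrite leq_eqVlt => /orP[/eqP->|/IHm le_i /pred_load] //.
  have [//|[pc [R enc]]] := state i.
  by move: load_i; rewrite (encodes_nullary _ enc) eq_sym gtn_eqF // st_gt0.
have sim j : let c := mexec q j (minit m) in
    encodes (rho (j + m.+1)%N) (Hs (j + m.+1)%N) (st c.1) c.2.
  elim: j => [|j IHj].
    have [o [s' [R' [t_in osem enc']]]] :=
      step_sound (load _ (leqnn m)) (steps m).
    case: (transitions_load t_in) enc' osem => -[-> ->] enc' /= R'E.
      by move: nload_Sm; rewrite (encodes_nullary _ enc').
    by rewrite add0n -R'E.
  have [o [s' [R' [t_in osem enc']]]] := step_sound IHj (steps _).
  have [s'E R'E] := transitions_sound t_in osem.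
  by rewrite s'E R'E -surjective_pairing in enc'.
move=> i; have [le_im|lt_mi] := leqP i m.
  by rewrite (encodes_nullary _ (load _ le_im)).
rewrite -(subnK lt_mi) (encodes_nullary _ (sim _)).
have := nhalt (i - m.+1); rewrite /halted -ltnNge => lt_pc.
by rewrite /st lt_pc.
Qed.

End Simulation.

Local Close Scope fset_scope.

(** * The sentence *)

Definition tokens (f : mso) : seq (nat + fol) := GenTree.encode (mso_enc f).

(** A tree node is encoded as [inl] of its tag plus one, then its children, then [inl 0]. A formula
    with one hole is thus a fixed prefix and suffix around the tokens of its argument. *)
Definition is_context (F : mso -> mso) : Prop :=
  exists A B, forall f, tokens (F f) = A ++ tokens f ++ B.

Lemma is_context_comp F G :
  is_context F -> is_context G -> is_context (fun f => F (G f)).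
Proof.
move=> [A [B FE]] [A' [B' GE]]; exists (A ++ A'), (B' ++ B) => f.
by rewrite FE GE -!catA.
Qed.

Lemma is_context_not : is_context MNot.
Proof.
by exists [:: inl 4], [:: inl 0] => f; rewrite /tokens /= cats0 -cats1.
Qed.

Lemma is_context_and f : is_context (MAnd f).
Proof.
exists (inl 5 :: tokens f), [:: inl 0] => g.
by rewrite /tokens /= cats0 -cats1 -catA.
Qed.

Lemma is_context_ex1 x : is_context (MEx1 x).
Proof.
exists [:: inl 6; inr (FEq x x)], [:: inl 0] => f.
by rewrite /tokens /= cats0 -cats1.
Qed.

Lemma tokens_iter F A B n f : (forall g, tokens (F g) = A ++ tokens g ++ B) ->
  tokens (iter n F f) = flatten (nseq n A) ++ tokens f ++ flatten (nseq n B).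
Proof.
move=> FE; elim: n => [|n IHn]; first by rewrite /= cats0.
have -> : flatten (nseq n.+1 B) = flatten (nseq n B) ++ B.
  by elim: (n) => [|k IHk] /=; rewrite ?cats0 // -catA -IHk.
by rewrite iterS FE IHn -!catA.
Qed.

Definition nullary (s x : nat) : mso := MAt (FAtom s.*2 [::]) x.

(** Variable 1 is the successor of variable 0, which is then rebound to it, so that the same context
    can be iterated. Equality of positions is expressed as the failure of both strict orders. *)
Definition next (f : mso) : mso :=
  MEx1 1 (MAnd
    (MAnd (MLt 0 1) (MNot (MEx1 2 (MAnd (MLt 0 2) (MLt 2 1)))))
    (MEx1 0 (MAnd (MAnd (MNot (MLt 0 1)) (MNot (MLt 1 0))) f))).

Definition load_ends : mso := MAnd (nullary 0 0) (next (MNot (nullary 0 0))).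

(** Having no predecessor pins variable 0 to the first position, where [f] is read. *)
Definition never_halts_if_at_start (f : mso) : mso :=
  MNot (MAnd (MEx1 0 (nullary 1 0))
             (MEx1 0 (MAnd (MNot (MEx1 1 (MLt 1 0))) f))).

Definition input_sentence (m : nat) : mso :=
  never_halts_if_at_start (iter m next load_ends).

Lemma msat_nullary rho px pX pd s x :
  msat rho px pX pd (nullary s x) <-> nullary_at (rho (px x)) s.
Proof. by split=> [[]|]. Qed.

(** The equivalence for [f] ranges over all assignments because the context rebinds variables 0 and
    1. *)
Lemma msat_next rho px pX pd f (P : nat -> Prop) :
    (forall px, msat rho px pX pd f <-> P (px 0)) ->
  msat rho px pX pd (next f) <-> P (px 0).+1.
Proof.
move=> fP; rewrite /next /= /upd /=; split.
  move=> [i [[lt_0i no_z] [j [[nlt_ij nlt_ji] /fP /=]]]].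
  have -> : j = (px 0).+1; last by [].
  have <- : i = j.
    by apply/anti_leq; rewrite (leqNgt i) (leqNgt j); apply/andP; split; apply/negP.
  apply/eqP; rewrite eqn_leq lt_0i andbT leqNgt; apply/negP => lt_i.
  by apply: no_z; exists (px 0).+1; rewrite ltnSn.
move=> Pi; exists (px 0).+1; split; first split=> //.
  by move=> [z [lt_0z]]; rewrite ltnS leqNgt lt_0z.
by exists (px 0).+1; split; [split; rewrite ltnn | apply/fP].
Qed.

Lemma msat_iter_next rho pX pd n f (P : nat -> Prop) :
    (forall px, msat rho px pX pd f <-> P (px 0)) ->
  forall px, msat rho px pX pd (iter n next f) <-> P (n + px 0).
Proof.
move=> fP; elim: n => [|n IHn] px //; rewrite iterS addSnnS.
exact: (@msat_next _ _ _ _ _ (fun i => P (n + i))).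
Qed.

Lemma models_input_sentence rho m :
  models rho (input_sentence m) <->
  ~ [/\ exists i, nullary_at (rho i) 1, nullary_at (rho m) 0
      & ~~ nullary_at (rho m.+1) 0].
Proof.
rewrite /models; set pd := fun=> 0; set pX := fun _ _ => _.
have endP px' : msat rho px' pX pd load_ends <->
    nullary_at (rho (px' 0)) 0 /\ ~~ nullary_at (rho (px' 0).+1) 0.
  have notP px1 : msat rho px1 pX pd (MNot (nullary 0 0)) <->
      ~~ nullary_at (rho (px1 0)) 0.
    have nulP := msat_nullary rho px1 pX pd 0 0.
    by split=> [no_load|/negP load /nulP //]; apply/negP => /nulP.
  have nextP := @msat_next _ px' _ _ _ (fun i => ~~ nullary_at (rho i) 0) notP.
  have nulP := msat_nullary rho px' pX pd 0 0.
  by split=> -[/nulP load /nextP nload].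
have iterP := @msat_iter_next _ _ _ m _ (fun i =>
  nullary_at (rho i) 0 /\ ~~ nullary_at (rho i.+1) 0) endP.
have haltP i := msat_nullary rho (upd (fun=> 0) 0 i) pX pd 1 0.
split=> [no [[i halt_i] load_m nload_m]|no [[i /haltP halt_i]]].
  apply: no; split; first by exists i; apply/haltP.
  by exists 0; split; [case | apply/iterP; rewrite /upd /= addn0].
move=> [j [first_j /iterP]]; rewrite /upd /=.
case: j first_j => [_|j first_j]; last by case: first_j; exists 0.
by rewrite addn0 => -[load_m nload_m]; apply: no; split=> //; exists i.
Qed.

Lemma wf_input_sentence M m : 1 < M -> wf_mso (parity_schema M) (input_sentence m).
Proof.
move=> M1; have w0 := wf_state (ltnW M1); have w1 := wf_state M1.
split=> //=; split=> //; elim: m => [|m IHm]; last by do !split.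
by rewrite /=; tauto.
Qed.

(** The invariant of the iteration is that 0 is the only free position variable; the outer
    quantifier binds it. *)
Lemma sentence_input_sentence m : sentence (input_sentence m).
Proof.
set f := iter m next load_ends.
have [fv1 fv2 fvd] : [/\ [seq x <- mfv1 f | x != 0] = [::],
    mfv2 f = [::] & mfvd f = [::]].
  rewrite {}/f; elim: m => [|m [IH1 IH2 IHd]] //=; split=> //.
  by rewrite IH1.
by split; rewrite /= -/f ?fv2 ?fvd //= fv1.
Qed.

Lemma input_sentence_code : exists A0 A1 A2 A3 A4, forall m,
  choice.pickle (input_sentence m) =
  CodeSeq.code (iterated_list A0 A1 A2 A3 A4 m).
Proof.
have [A [B nextE]] : is_context next.
  exact: is_context_comp (is_context_ex1 1) (is_context_comp (is_context_and _)
    (is_context_comp (is_context_ex1 0) (is_context_and _))).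
have [A' [B' topE]] : is_context never_halts_if_at_start.
  exact: is_context_comp is_context_not (is_context_comp (is_context_and _)
    (is_context_comp (is_context_ex1 0) (is_context_and _))).
pose code := map (@choice.pickle (nat + fol)%type).
exists (code A'), (code A), (code (tokens load_ends)), (code B), (code B') => m.
(* By computation, pickling a formula codes the list of the pickled tokens of its tree. *)
transitivity (CodeSeq.code (code (tokens (input_sentence m)))) => //.
rewrite topE (tokens_iter _ _ nextE) /iterated_list /code !map_cat !map_flatten.
by rewrite !map_nseq -!catA.
Qed.

(** * The diagonal instance *)

Theorem theorem4p1 : undecidable mc_wf mc_yes.
Proof.
move=> [p p_dec].
have [A0 [A1 [A2 [A3 [A4 codeE]]]]] := input_sentence_code.
have [q q_flips] := diagonal_program A0 A1 A2 A3 A4 p.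
have [M bound] := automaton_bound (transitions q).
pose sD : schema * dms := (parity_schema M, automaton_dms (transitions q)).
(* The input of [q] is the code of the system that simulates [q], kept behind an equation so that it
   is not unfolded. *)
have [m mE] : exists m, m = choice.pickle sD by exists (choice.pickle sD).
pose x : mc_input := (sD, input_sentence m).
have M1 : 1 < M by have [] := bound (1, ONop, 1) _; rewrite // !inE eqxx !orbT.
have x_wf : mc_wf x.
  split; last exact: sentence_input_sentence; last exact: wf_input_sentence.
  exact: wf_automaton_dms (ltnW M1) bound.
have xE : choice.pickle x = diagonal_code A0 A1 A2 A3 A4 m.
  transitivity (CodeSeq.code
    [:: choice.pickle sD; choice.pickle (input_sentence m)]); first by [].
  by rewrite -mE codeE.
have [n] := p_dec x x_wf; rewrite xE => -[/q_flips[q_halts q_loops]].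
case=> -[answer yes].
  (* Acceptance makes [q] halt on [m], and the run simulating this computation violates the accepted
     sentence. *)
  have [j halt_j] : exists j, halted q (mexec q j (minit m)).
    by apply: q_halts; rewrite answer.
  have [rho rho_run [load_m nload_m halt_rho]] := halting_run halt_j.
  have model : models rho (input_sentence m) := yes _ rho_run.
  by move/models_input_sentence: model; apply.
(* Rejection makes [q] diverge on [m], so every run satisfies the rejected sentence. *)
apply: yes => rho rho_run; apply/models_input_sentence => -[[i halt_i] load_m].
move=> nload_m; apply/negP: halt_i.
exact: nonhalting_run (q_loops answer) rho_run load_m nload_m i.
Qed.
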